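(* Let $n,p\ge 1$, $\lambda\ge 0$, and let $\Sigma$ be an $n$-dimensional complete (without boundary) $\lambda$-submanifold properly immersed in the Gauss space $\mathbb G^{n+p}$. Let $k\in\{p,p+1,\dots,n+p-2\}$, $q=n+p-k-1$ and $r=\frac{-\lambda+\sqrt{\lambda^2+4(n-q)}}{2}$. If $\Sigma\subset\overline{B^{k+1}(r)}\times\mathbb R^q$, then $\Sigma\subset S^k(r)\times\mathbb R^q$.
   Context: The Gauss space $\mathbb G^m$ is $\mathbb R^m$ with its Euclidean metric and the density $e^{-f}=(2\pi)^{-m/2}e^{-|X|^2/2}$, where $X$ is the position vector. For an $n$-dimensional submanifold $\Sigma$ of $\mathbb G^{n+p}$, $\mathbf H$ denotes the mean curvature vector (the trace of the second fundamental form, not divided by $n$), $X^\perp$ the component of $X$ normal to $\Sigma$, and $\mathbf H_f=\mathbf H+X^\perp$ the weighted mean curvature vector. $\Sigma$ is a $\lambda$-submanifold if $|\mathbf H_f|=\lambda$ on $\Sigma$ for a constant $\lambda\ge 0$. $\mathbb R^{n+p}$ is identified with the orthogonal product $\mathbb R^{k+1}\times\mathbb R^{q}$; $\overline{B^{k+1}(r)}=\{u\in\mathbb R^{k+1}:|u|\le r\}$ and $S^k(r)=\{u\in\mathbb R^{k+1}:|u|=r\}$ are the closed ball and sphere of radius $r$ centered at the origin. *)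

(* Defs.v *)
(* MathComp-Analysis. Vectors of R^m are row vectors 'rV[R]_m. The library norm
   `|u| on 'rV[R]_m is the sup norm: it is used only through the topology, and
   all metric notions below use the Euclidean norm [enorm]. *)
From HB Require Import structures.
From mathcomp Require Import all_boot all_order all_algebra.
From mathcomp Require Import all_classical all_reals all_analysis.

Set Implicit Arguments.
Unset Strict Implicit.
Unset Printing Implicit Defensive.

Import Order.TTheory GRing.Theory Num.Theory.
Import numFieldNormedType.Exports.

Local Open Scope classical_set_scope.
Local Open Scope ring_scope.

Definition edot (R : realType) (m : nat) (u v : 'rV[R]_m) : R :=
  \sum_(i < m) u 0 i * v 0 i.

Definition enorm (R : realType) (m : nat) (u : 'rV[R]_m) : R :=
  Num.sqrt (edot u u).

(* [iter_derive f [:: v1; ...; vl]] is D_v1 (... (D_vl f)). *)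
Definition iter_derive (R : realType) (n m : nat) (f : 'rV[R]_n -> 'rV[R]_m)
    (vs : seq 'rV[R]_n) : 'rV[R]_n -> 'rV[R]_m :=
  foldr (fun v g x => 'D_v g x) f vs.

(* C^oo on U, meant for U open: all iterated directional derivatives exist and
   are differentiable (hence continuous) on U. *)
Definition smooth_on (R : realType) (n m : nat) (U : set 'rV[R]_n)
    (f : 'rV[R]_n -> 'rV[R]_m) : Prop :=
  forall (vs : seq 'rV[R]_n) (x : 'rV[R]_n), U x ->
    differentiable (iter_derive f vs) x.

(* A homeomorphism [coord], with inverse [param], from the open set [chart_dom]
   of M onto an open subset of R^n; the values of [coord] off [chart_dom], and
   of [param] off [coord @` chart_dom], are irrelevant. *)
Record chart (R : realType) (n : nat) (M : topologicalType) := Chart {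
  chart_dom : set M ;
  coord : M -> 'rV[R]_n ;
  param : 'rV[R]_n -> M ;
  dom_open : open chart_dom ;
  codom_open : open (coord @` chart_dom) ;
  coordK : forall x, chart_dom x -> param (coord x) = x ;
  coord_continuous : {within chart_dom, continuous coord} ;
  param_continuous : {within coord @` chart_dom, continuous param} }.

Definition chart_codom (R : realType) (n : nat) (M : topologicalType)
  (c : chart R n M) : set 'rV[R]_n := coord c @` chart_dom c.

(* M with the atlas A is an n-dimensional smooth manifold without boundary,
   not necessarily connected. *)
Definition smooth_manifold (R : realType) (n : nat) (M : topologicalType)
    (A : set (chart R n M)) : Prop :=
  [/\ hausdorff_space M,
      @second_countable M,
      forall x : M, exists2 c, A c & chart_dom c x &
      forall c c', A c -> A c' ->
        smooth_on (coord c @` (chart_dom c `&` chart_dom c'))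
                  (coord c' \o param c)].

(* The rows of 'J g y are the partial derivatives of g (row-vector convention),
   so [row_free] says that the differential is injective. *)
Definition smooth_immersion (R : realType) (n m : nat) (M : topologicalType)
    (A : set (chart R n M)) (F : M -> 'rV[R]_m) : Prop :=
  forall c, A c ->
    smooth_on (chart_codom c) (F \o param c) /\
    (forall y, chart_codom c y -> row_free ('J (F \o param c) y)).

Definition proper_map (T U : topologicalType) (f : T -> U) : Prop :=
  continuous f /\ forall K : set U, compact K -> compact (f @^-1` K).

(* First fundamental form, at y, of an immersed parametrization g : R^n -> R^m:
   its entries are <D_i g, D_j g>. *)
Definition gram (R : realType) (n m : nat) (g : 'rV[R]_n -> 'rV[R]_m)
    (y : 'rV[R]_n) : 'M[R]_n :=
  'J g y *m ('J g y)^T.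

(* The subtracted term is \sum_(i, j) g^{ij} <v, D_i g> D_j g, the orthogonal
   projection of v onto the tangent space. *)
Definition normal_part (R : realType) (n m : nat) (g : 'rV[R]_n -> 'rV[R]_m)
    (y : 'rV[R]_n) (v : 'rV[R]_m) : 'rV[R]_m :=
  v - v *m ('J g y)^T *m invmx (gram g y) *m 'J g y.

(* B(a, b) is the normal part of the ambient derivative along a of the field
   D_b g, for tangent vectors given by their coordinates a, b. *)
Definition second_ff (R : realType) (n m : nat) (g : 'rV[R]_n -> 'rV[R]_m)
    (y a b : 'rV[R]_n) : 'rV[R]_m :=
  normal_part g y ('D_a (fun z => 'D_b g z) y).

Definition mean_curvature (R : realType) (n m : nat)
    (g : 'rV[R]_n -> 'rV[R]_m) (y : 'rV[R]_n) : 'rV[R]_m :=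
  \sum_(i < n) \sum_(j < n)
    invmx (gram g y) i j *: second_ff g y (delta_mx 0 i) (delta_mx 0 j).

(* H_f = H + X^perp, for the Gaussian density e^{-f}, where grad f = X. *)
Definition weighted_mean_curvature (R : realType) (n m : nat)
    (g : 'rV[R]_n -> 'rV[R]_m) (y : 'rV[R]_n) : 'rV[R]_m :=
  mean_curvature g y + normal_part g y (g y).

Definition lambda_submanifold (R : realType) (n m : nat) (M : topologicalType)
    (A : set (chart R n M)) (F : M -> 'rV[R]_m) (lambda : R) : Prop :=
  forall c x, A c -> chart_dom c x ->
    enorm (weighted_mean_curvature (F \o param c) (coord c x)) = lambda.

(* C^1 curves are parametrized by the whole line, but only their restriction to
   [0, 1] is measured: every C^1 curve on [0, 1] is such a restriction. *)
Definition C1_curve (R : realType) (n : nat) (M : topologicalType)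
    (A : set (chart R n M)) (gamma : R -> M) : Prop :=
  continuous gamma /\
  forall c (t : R), A c -> chart_dom c (gamma t) ->
    derivable (coord c \o gamma) t 1 /\
    {for t, continuous (derive1 (coord c \o gamma))}.

(* Length in the metric induced by F. *)
Definition curve_length (R : realType) (m : nat) (M : topologicalType)
    (F : M -> 'rV[R]_m) (gamma : R -> M) : \bar R :=
  (\int[@lebesgue_measure R]_(t in `[0%R, 1%R])
     (enorm (derive1 (F \o gamma) t))%:E)%E.

(* Equal to +oo between distinct components of M. *)
Definition riemannian_dist (R : realType) (n m : nat) (M : topologicalType)
    (A : set (chart R n M)) (F : M -> 'rV[R]_m) (x y : M) : \bar R :=
  ereal_inf [set curve_length F gamma | gamma in
    [set gamma : R -> M | [/\ C1_curve A gamma, gamma 0 = x & gamma 1 = y]]].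

(* Limits are taken in the manifold topology, which is also the topology of the
   Riemannian distance. *)
Definition complete_submanifold (R : realType) (n m : nat)
    (M : topologicalType) (A : set (chart R n M)) (F : M -> 'rV[R]_m) : Prop :=
  forall s : nat -> M,
    (forall e : R, 0 < e -> exists N : nat, forall i j : nat,
        (N <= i)%N -> (N <= j)%N ->
        (riemannian_dist A F (s i) (s j) < e%:E)%E) ->
    exists x : M, s @ \oo --> x.

(* The identification of R^N with R^a x R^b: first a, then last b
   coordinates. *)
Definition split_coords (R : realType) (N a b : nat) (e : N = (a + b)%N)
    (X : 'rV[R]_N) : 'rV[R]_a * 'rV[R]_b :=
  let Y := castmx (erefl 1%N, e) X in (lsubmx Y, rsubmx Y).

Definition eclosed_ball (R : realType) (m : nat) (r : R) : set 'rV[R]_m :=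
  [set u | enorm u <= r].

Definition esphere (R : realType) (m : nat) (r : R) : set 'rV[R]_m :=
  [set u | enorm u = r].

(* Main.v *)
(* Let u be the first k+1 coordinates of X and Delta_f = Delta - <X^T, grad>.
   Since Delta_f X = H_f - X and the squared gradients of the last q coordinates
   add up to at most q,
     Delta_f (|u|^2 / 2) >= n - q - lambda |u| - |u|^2
                          = (r - |u|)(r + |u| + lambda) >= 0,
   so |u|^2 is Delta_f-subharmonic. By Hopf's strong maximum principle the set
   |u| = r is open, so its complement O is open and closed. On the other hand
     Delta_f (|X|^2 / 2) <= n + lambda |X| - |X|^2
   is negative far away, and by properness |u|^2 - eps |X|^2 attains its maximum
   over O if O is not empty; for small eps the two inequalities exclude this. *)
Require Import Defs.
From HB Require Import structures.
From mathcomp Require Import all_boot all_order all_algebra.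
From mathcomp Require Import all_classical all_reals all_analysis.
From mathcomp Require Import zify ring lra.

Set Implicit Arguments.
Unset Strict Implicit.
Unset Printing Implicit Defensive.

Import Order.TTheory GRing.Theory Num.Theory.
Import numFieldNormedType.Exports.

Local Open Scope classical_set_scope.
Local Open Scope ring_scope.

(** * Second derivatives along lines *)

(** The constant r is the positive root of r^2 + lambda r = n - q, which is what makes the lower
    bound factor through r - |u|. M may be disconnected and the set |u| = r may be empty, so the
    strong maximum principle cannot conclude alone. Openness of O turns a maximum over O into a
    local one, where derivatives can be tested. Closedness of O keeps r - |u| away from 0 on the
    part of O lying over a compact ball of the ambient space, so that one eps serves all its points.
    Every differential step takes place in one chart. There L is a sum of second derivatives along
    vectors frozen at the point, plus a drift, so an extremum is tested by one-variable calculus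
    along lines, without eigenvalues or Christoffel symbols. The strong principle uses a barrier
    that is quadratic in the squared distance: a polynomial, with exact derivatives, smooth at the
    center of the ball as well. *)

Section jets.
Variables (R : realType) (V : normedModType R).
Implicit Types (g h : V -> R) (y v : V) (a b : R).

(* The 2-jet at y of the restriction of g to the line y + R v. *)
Definition jet2 g y v a b : Prop :=
  [/\ \forall z \near y, derivable g z v, 'D_v g y = a &
      is_derive y v ('D_v g) b].

(** Bridge to one variable: the two difference quotients are the same function of [s], so
    derivability and derivatives transfer by rewriting. *)
Lemma derive_line_quotient g y v (t : R) :
  (fun s : R => s^-1 *: (((fun t : R => g (t *: v + y)) \o shift t) (s *: 1)
                           - g (t *: v + y))) =
  (fun s : R => s^-1 *: ((g \o shift (t *: v + y)) (s *: v) - g (t *: v + y))).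
Proof.
by apply/funext => s /=; rewrite [s *: 1]mulr1 scalerDl addrA.
Qed.

Lemma derivable_line g y v (t : R) :
  derivable g (t *: v + y) v -> derivable (fun t : R => g (t *: v + y)) t 1.
Proof. by rewrite /derivable derive_line_quotient. Qed.

Lemma derive_line g y v (t : R) :
  'D_1 (fun t : R => g (t *: v + y)) t = 'D_v g (t *: v + y).
Proof. by rewrite /derive derive_line_quotient. Qed.

Lemma near_line y v (P : V -> Prop) :
  (\forall z \near y, P z) -> \forall t \near (0 : R), P (t *: v + y).
Proof.
move=> Py.
have cl : t *: v + y @[t --> (0 : R)] --> 0 *: v + y.
  by apply: cvgD; [exact: scalel_continuous|exact: cvg_cst].
by move: cl; rewrite scale0r add0r; apply.
Qed.

(** Restricted to the line, g has derivative 0 at the minimum. If b were negative, this derivative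
    would be negative just to the right of 0, and the mean value theorem would give a smaller value
    there. *)
Lemma jet2_min g y v a b : (\forall z \near y, g y <= g z) ->
  jet2 g y v a b -> a = 0 /\ 0 <= b.
Proof.
move=> gmin [dg ga db].
pose phi (t : R) := g (t *: v + y).
have phi0 : phi 0 = g y by rewrite /phi scale0r add0r.
have /nbhs_ballP[d /= d0 dP] : \forall t \near (0 : R),
    phi 0 <= phi t /\ derivable g (t *: v + y) v.
  rewrite phi0.
  apply: (@near_line y v (fun z => g y <= g z /\ derivable g z v)).
  near=> z; split; by near: z.
have dphi t : `|t| < d -> derivable phi t 1.
  by move=> td; apply: derivable_line; apply dP; rewrite /ball/= sub0r normrN.
have phimin t : `|t| < d -> phi 0 <= phi t.
  by move=> td; apply dP; rewrite /ball/= sub0r normrN.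
have d1 t : 'D_1 phi t = 'D_v g (t *: v + y) by exact: derive_line.
have a0 : a = 0.
  have m0 : 0 \in `](- d), d[%R by rewrite in_itv/= oppr_lt0 d0.
  have := @derive1_at_min R phi (- d) d 0 _ _ m0 _.
  rewrite -ga => H.
  have [|t|t|_ <-] := H.
  - by rewrite ge0_cp // ltW.
  - by rewrite in_itv/= => /andP[t1 t2]; apply: dphi; rewrite ltr_norml t1.
  - by rewrite in_itv/= => /andP[t1 t2]; apply: phimin; rewrite ltr_norml t1.
  - by rewrite d1 scale0r add0r.
split=> //; rewrite leNgt; apply/negP => b0.
case: db => ddg Db.
have /cvg_ex := ddg => -[l gl].
have lb : l = b by rewrite -Db; apply/esym/cvg_lim.
subst l.
have {}gl : \forall t \near (0 : R), t != 0 ->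
    t^-1 *: (('D_v g \o shift y) (t *: v) - 'D_v g y) < 0.
  by have := cvgr_lt _ gl _ b0; rewrite near_withinE; exact.
have /nbhs_ballP[e /= e0 eP] := gl.
have neg t : 0 < t -> t < e -> 'D_1 phi t < 0.
  move=> t0 te; have := eP t.
  rewrite /ball/= sub0r normrN gtr0_norm// => /(_ te).
  rewrite gt_eqF// => /(_ isT).
  by rewrite ga a0 subr0 d1 /= [_ *: _]mulrC pmulr_llt0 ?invr_gt0.
pose c := Num.min d e / 2.
have m0 : 0 < Num.min d e by rewrite lt_min d0.
have c0 : 0 < c by rewrite divr_gt0.
have cm : c < Num.min d e by rewrite ltr_pdivrMr// ltr_pMr// ltr1n.
have [cd ce] : c < d /\ c < e by move: cm; rewrite lt_min => /andP.
have [||x] := @MVT R phi ('D_1 phi) 0 c c0.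
- move=> x; rewrite in_itv/= => /andP[x0 xc]; apply: derivableP; apply: dphi.
  by rewrite gtr0_norm// (lt_trans xc).
- apply: derivable_within_continuous => x; rewrite in_itv/= => /andP[x0 xc].
  by apply: dphi; rewrite ger0_norm// (le_lt_trans xc).
rewrite in_itv/= => /andP[x0 xc] E.
have : phi c - phi 0 < 0.
  by rewrite E subr0 pmulr_llt0// neg// (lt_trans xc).
by rewrite ltNge subr_ge0 phimin// gtr0_norm.
Unshelve. all: by end_near. Qed.

Lemma jet2_cst (k : R) y v : jet2 (cst k) y v 0 0.
Proof.
have E : 'D_v (cst k : V -> R) = cst 0 by apply/funext=> z; exact: derive_cst.
split; last 1 first.
- by rewrite E; exact: is_derive_cst.
- by near=> z; exact: derivable_cst.
- exact: derive_cst.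
Unshelve. all: by end_near. Qed.

Lemma jet2D g h y v a b a' b' : jet2 g y v a b -> jet2 h y v a' b' ->
  jet2 (g + h) y v (a + a') (b + b').
Proof.
move=> [dg <- ddg] [dh <- ddh]; split.
- by apply: filterS2 dg dh => z; exact: derivableD.
- exact: deriveD (nbhs_singleton dg) (nbhs_singleton dh).
- have E : \forall z \near y, ('D_v g + 'D_v h : V -> R) z = 'D_v (g + h) z.
    by apply: filterS2 dg dh => z zg zh; rewrite (deriveD zg zh).
  exact: near_eq_is_derive E (is_deriveD ddg ddh).
Qed.

Lemma jet2M g h y v a b a' b' : jet2 g y v a b -> jet2 h y v a' b' ->
  jet2 (g * h) y v (g y * a' + h y * a)
    (g y * b' + h y * b + 2 * a * a').
Proof.
move=> [dg ga ddg] [dh ha ddh].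
have dgy := nbhs_singleton dg; have dhy := nbhs_singleton dh.
split.
- by apply: filterS2 dg dh => z; exact: derivableM.
- by rewrite (deriveM dgy dhy) ga ha.
- have E : \forall z \near y,
      (g * 'D_v h + h * 'D_v g : V -> R) z = 'D_v (g * h) z.
    by apply: filterS2 dg dh => z zg zh; rewrite (deriveM zg zh).
  apply: (near_eq_is_derive E).
  have jg := derivableP dgy; have jh := derivableP dhy.
  apply: (is_derive_eq (is_deriveD (is_deriveM jg ddh) (is_deriveM jh ddg))).
  rewrite ga ha.
  by change (g y * b' + a' * a + (h y * b + a * a') =
    g y * b' + h y * b + 2 * a * a'); ring.
Qed.

Lemma jet2Z g (k : R) y v a b : jet2 g y v a b ->
  jet2 (fun z => k * g z) y v (k * a) (k * b).
Proof.
move=> jg; have := jet2M (jet2_cst k y v) jg.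
by rewrite mulr0 !addr0 mulr0 mul0r addr0.
Qed.

Lemma jet2_sum (I : Type) (s : seq I) (P : pred I) (G : I -> V -> R) y v
    (a b : I -> R) : (forall i, P i -> jet2 (G i) y v (a i) (b i)) ->
  jet2 (fun z => \sum_(i <- s | P i) G i z) y v
    (\sum_(i <- s | P i) a i) (\sum_(i <- s | P i) b i).
Proof.
move=> jG; elim: s => [|i s IH].
  rewrite !big_nil; under eq_fun do rewrite big_nil.
  exact: jet2_cst.
rewrite !big_cons; under eq_fun do rewrite big_cons.
case: ifPn => // Pi.
exact: jet2D (jG _ Pi) IH.
Qed.

End jets.

(** * Tangential projections *)

Section euclidean.
Variable R : realType.

Lemma edotE (m : nat) (u v : 'rV[R]_m) : edot u v = (u *m v^T) 0 0.
Proof. by rewrite mxE; apply: eq_bigr => i _; rewrite mxE. Qed.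

Lemma edot_ge0 (m : nat) (u : 'rV[R]_m) : 0 <= edot u u.
Proof. by apply: sumr_ge0 => i _; rewrite -expr2 sqr_ge0. Qed.

Lemma edot_eq0 (m : nat) (u : 'rV[R]_m) : edot u u = 0 -> u = 0.
Proof.
move=> /eqP; rewrite psumr_eq0; last by move=> i _; rewrite -expr2 sqr_ge0.
move=> /allP h; apply/rowP => i; rewrite mxE.
by have := h i (mem_index_enum i); rewrite mulf_eq0 orbb => /eqP.
Qed.

Lemma enormK (m : nat) (u : 'rV[R]_m) : enorm u ^+ 2 = edot u u.
Proof. by rewrite sqr_sqrtr// edot_ge0. Qed.

Lemma ler_sum_cauchy_schwarz (I : finType) (P : pred I) (x y : I -> R) :
  `|\sum_(i | P i) x i * y i| <=
  Num.sqrt (\sum_(i | P i) x i ^+ 2) * Num.sqrt (\sum_(i | P i) y i ^+ 2).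
Proof.
set A := \sum_(i | P i) x i ^+ 2; set B := \sum_(i | P i) y i ^+ 2.
set D := \sum_(i | P i) x i * y i.
have A0 : 0 <= A by apply: sumr_ge0 => i _; exact: sqr_ge0.
have B0 : 0 <= B by apply: sumr_ge0 => i _; exact: sqr_ge0.
rewrite -sqrtrM// -sqrtr_sqr ler_wsqrtr//.
have quad (s t : R) : 0 <= s ^+ 2 * A - 2 * s * t * D + t ^+ 2 * B.
  have -> : s ^+ 2 * A - 2 * s * t * D + t ^+ 2 * B =
      \sum_(i | P i) (s * x i - t * y i) ^+ 2.
    rewrite /A /B /D !mulr_sumr -sumrB -big_split/=.
    by apply: eq_bigr => i _; ring.
  by apply: sumr_ge0 => i _; exact: sqr_ge0.
(* If A = 0, then s = D (B + 1) and t = D^2 give - (B + 2) D^4 >= 0, hence D = 0. Otherwise s = D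
   and t = A give A (A B - D^2) >= 0. *)
have [A00|Ap] := eqVneq A 0.
  have := quad (D * (B + 1)) (D ^+ 2); have := quad D 1.
  have := quad (D * (B + 1)) 1.
  rewrite A00; nra.
have {Ap}Ap : 0 < A by rewrite lt_neqAle eq_sym Ap.
have := quad D A; nra.
Qed.

Variables n m : nat.
Implicit Types J : 'M[R]_(n, m).

(** A row z in the kernel of the Gram matrix satisfies |z J|^2 = z J J^T z^T = 0. *)
Lemma mulmx_tr_unit J : row_free J -> J *m J^T \in unitmx.
Proof.
move=> fJ; rewrite -row_free_unit -kermx_eq0; apply/eqP/row_matrixP => i.
rewrite row0; set z := row i _.
have zG : z *m (J *m J^T) = 0 by apply/sub_kermxP; exact: row_sub.
have zJ : z *m J = 0.
  apply: edot_eq0; rewrite edotE trmx_mul.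
  by rewrite -mulmxA (mulmxA J) mulmxA zG mul0mx mxE.
by apply: (row_free_inj fJ); rewrite zJ mul0mx.
Qed.

(* If the rows of J are the D_i f, then the columns v_l of [coframe J] satisfy
   \sum_l v_l^T v_l = (g^{ij}): the metric trace of a Hessian is a plain sum of
   second derivatives along the v_l, one for each ambient coordinate. *)
Definition coframe J := invmx (J *m J^T) *m J.

(** The orthogonal projection of the ambient space onto the row space of [J], that is, onto the
    tangent space. *)
Definition tangent_proj J := J^T *m coframe J.

Lemma invmx_gram_sym J : (invmx (J *m J^T))^T = invmx (J *m J^T).
Proof. by rewrite trmx_inv trmx_mul trmxK. Qed.

Lemma coframe_mulmx_tr J : row_free J ->
  coframe J *m (coframe J)^T = invmx (J *m J^T).
Proof.
move=> fJ; rewrite /coframe trmx_mul invmx_gram_sym -!mulmxA (mulmxA J).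
by rewrite mulmxV ?mulmx1// mulmx_tr_unit.
Qed.

(** Ellipticity of L: no nonzero covector annihilates all the frame vectors. *)
Lemma coframe_inj J (z : 'rV[R]_n) : row_free J -> z *m coframe J = 0 -> z = 0.
Proof.
move=> fJ; rewrite mulmxA => h.
have : z *m invmx (J *m J^T) = 0 by apply: (row_free_inj fJ); rewrite h mul0mx.
move=> /(congr1 (mulmx^~ (J *m J^T))).
by rewrite mulmxKV ?mulmx_tr_unit// mul0mx.
Qed.

Lemma tangent_proj_sym J : (tangent_proj J)^T = tangent_proj J.
Proof.
by rewrite /tangent_proj /coframe !trmx_mul invmx_gram_sym trmxK mulmxA.
Qed.

Lemma tangent_proj_tr J : (coframe J)^T *m J = tangent_proj J.
Proof. by rewrite -(trmxK J) -trmx_mul trmxK tangent_proj_sym. Qed.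

Lemma tangent_proj_idem J : row_free J ->
  tangent_proj J *m tangent_proj J = tangent_proj J.
Proof.
move=> fJ; rewrite /tangent_proj /coframe -!mulmxA (mulmxA J J^T).
by rewrite (mulmxA (invmx _) (J *m J^T)) mulVmx ?mul1mx// mulmx_tr_unit.
Qed.

Lemma tangent_proj_trace J : row_free J -> \tr (tangent_proj J) = n%:R.
Proof.
by move=> fJ; rewrite mxtrace_mulC -mulmxA mulVmx ?mxtrace1// mulmx_tr_unit.
Qed.

(** A diagonal entry of T^T T = T, where T is the projection. The left side is the form in which the
    product rule yields |grad x_i|^2. *)
Lemma tangent_proj_diag J (i : 'I_m) : row_free J ->
  \sum_(l < m) tangent_proj J l i ^+ 2 = tangent_proj J i i.
Proof.
move=> fJ; rewrite -[in RHS]tangent_proj_idem// mxE; apply: eq_bigr => l _.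
suff -> : tangent_proj J i l = tangent_proj J l i by [].
by rewrite -[X in fun_of_matrix X i l]tangent_proj_sym [LHS]mxE.
Qed.

(** By [tangent_proj_diag] the entry p satisfies p = p^2 + s with s >= 0. *)
Lemma tangent_proj_diag_le1 J (i : 'I_m) : row_free J ->
  tangent_proj J i i <= 1.
Proof.
move=> fJ; have := tangent_proj_diag i fJ; rewrite (bigD1 i)//=.
have : 0 <= \sum_(l < m | l != i) tangent_proj J l i ^+ 2.
  by apply: sumr_ge0 => l _; exact: sqr_ge0.
set p := tangent_proj J i i; move: (\sum_(l < m | _) _) => s s0 E.
rewrite leNgt; apply/negP => gt1; nra.
Qed.

Lemma tangent_proj_diag_ge0 J (i : 'I_m) : row_free J ->
  0 <= tangent_proj J i i.
Proof.
move=> fJ; rewrite -tangent_proj_diag//.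
by apply: sumr_ge0 => l _; exact: sqr_ge0.
Qed.

(** The trace is n and each coordinate outside [P] takes away at most 1: the source of n - q. *)
Lemma tangent_proj_diag_sum_ge J (P : pred 'I_m) : row_free J ->
  n%:R - #|[pred i | ~~ P i]|%:R <= \sum_(i | P i) tangent_proj J i i.
Proof.
move=> fJ; rewrite lerBlDr -(tangent_proj_trace fJ) /mxtrace (bigID P)/=.
rewrite lerD2l -sum1_card natr_sum/=.
by apply: ler_sum => i _; exact: tangent_proj_diag_le1.
Qed.

End euclidean.

(** * Continuity of matrix-valued functions *)

Section entrywise_continuity.
Variables (R : realType) (T : topologicalType).

Definition entrywise_continuous_at (m n : nat) (y : T)
    (A : T -> 'M[R]_(m, n)) :=
  forall i j, {for y, continuous (fun z => A z i j)}.

Lemma eq_continuous_at (y : T) (f g : T -> R) : g =1 f ->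
  {for y, continuous f} -> {for y, continuous g}.
Proof. by move=> /funext ->. Qed.

Lemma continuous_atD (y : T) (f g : T -> R) : {for y, continuous f} ->
  {for y, continuous g} -> {for y, continuous (fun z => f z + g z)}.
Proof. by move=> cf cg; apply: cvgD; [exact: cf|exact: cg]. Qed.

Lemma continuous_atB (y : T) (f g : T -> R) : {for y, continuous f} ->
  {for y, continuous g} -> {for y, continuous (fun z => f z - g z)}.
Proof. by move=> cf cg; apply: cvgB; [exact: cf|exact: cg]. Qed.

Lemma continuous_atM (y : T) (f g : T -> R) : {for y, continuous f} ->
  {for y, continuous g} -> {for y, continuous (fun z => f z * g z)}.
Proof. by move=> cf cg; apply: cvgM; [exact: cf|exact: cg]. Qed.

Lemma continuous_at_sum (I : Type) (s : seq I) (P : pred I) (y : T)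
    (F : I -> T -> R) : (forall i, P i -> {for y, continuous (F i)}) ->
  {for y, continuous (fun z => \sum_(i <- s | P i) F i z)}.
Proof. by move=> cF; apply: cvg_big => //; exact: add_continuous. Qed.

Lemma continuous_at_prod (I : Type) (s : seq I) (P : pred I) (y : T)
    (F : I -> T -> R) : (forall i, P i -> {for y, continuous (F i)}) ->
  {for y, continuous (fun z => \prod_(i <- s | P i) F i z)}.
Proof. by move=> cF; apply: cvg_big => //; exact: mul_continuous. Qed.

Lemma entrywise_continuous_mul m n p y (A : T -> 'M[R]_(m, n))
    (B : T -> 'M[R]_(n, p)) :
  entrywise_continuous_at y A -> entrywise_continuous_at y B ->
  entrywise_continuous_at y (fun z => A z *m B z).
Proof.
move=> cA cB i j; apply: eq_continuous_at => [z|]; first by rewrite mxE.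
by apply: continuous_at_sum => k _; apply: cvgM; [exact: cA|exact: cB].
Qed.

Lemma entrywise_continuous_tr m n y (A : T -> 'M[R]_(m, n)) :
  entrywise_continuous_at y A -> entrywise_continuous_at y (fun z => (A z)^T).
Proof.
by move=> cA i j; apply: eq_continuous_at (cA j i) => z; rewrite mxE.
Qed.

Lemma entrywise_continuous_add m n y (A B : T -> 'M[R]_(m, n)) :
  entrywise_continuous_at y A -> entrywise_continuous_at y B ->
  entrywise_continuous_at y (fun z => A z + B z).
Proof.
move=> cA cB i j; apply: eq_continuous_at => [z|]; first by rewrite mxE.
by apply: cvgD; [exact: cA|exact: cB].
Qed.

Lemma entrywise_continuous_opp m n y (A : T -> 'M[R]_(m, n)) :
  entrywise_continuous_at y A -> entrywise_continuous_at y (fun z => - A z).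
Proof.
move=> cA i j; apply: eq_continuous_at => [z|]; first by rewrite mxE.
by apply: cvgN; exact: cA.
Qed.

Lemma entrywise_continuous_cst m n y (A : 'M[R]_(m, n)) :
  entrywise_continuous_at y (fun=> A).
Proof. by move=> i j; exact: cvg_cst. Qed.

Lemma continuous_at_det n y (A : T -> 'M[R]_n) :
  entrywise_continuous_at y A -> {for y, continuous (fun z => \det (A z))}.
Proof.
move=> cA; apply: continuous_at_sum => s _; apply: cvgM; first exact: cvg_cst.
by apply: continuous_at_prod => i _; exact: cA.
Qed.

(** Cramer's rule. On singular matrices [invmx] is the identity, so the formula is used only where
    the determinant stays nonzero, which is a neighborhood of y. *)
Lemma entrywise_continuous_invmx n y (A : T -> 'M[R]_n) : A y \in unitmx ->
  entrywise_continuous_at y A ->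
  entrywise_continuous_at y (fun z => invmx (A z)).
Proof.
move=> uA cA i j; have dA := continuous_at_det cA.
have dAy : \det (A y) != 0 by rewrite -unitfE -unitmxE.
have near_unit : \forall z \near y, A z \in unitmx.
  have : \forall z \near y, \det (A z) != 0 by exact: (cvgr_neq0 _ dA dAy).
  by apply: filterS => z; rewrite unitmxE unitfE.
have eqA : \forall z \near y,
    (\det (A z))^-1 * cofactor (A z) j i = invmx (A z) i j.
  by apply: filterS near_unit => z uz; rewrite /invmx uz !mxE.
suff : (\det (A z))^-1 * cofactor (A z) j i @[z --> y] --> invmx (A y) i j.
  by apply: cvg_trans; exact: near_eq_cvg eqA.
rewrite -(nbhs_singleton eqA); apply: cvgM; first exact: cvgV.
apply: cvgM; first exact: cvg_cst.
apply: continuous_at_det => k l.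
by apply: eq_continuous_at (cA (lift j k) (lift i l)) => z; rewrite !mxE.
Qed.

End entrywise_continuity.

(** * The drift Laplacian in a chart *)

Section operator.
Variables (R : realType) (n m : nat).
Implicit Types (C : 'M[R]_(n, m)) (b y : 'rV[R]_n) (g : 'rV[R]_n -> R).

Definition frame_vec C (l : 'I_m) : 'rV[R]_n := row l C^T.

(* L g (y) = c for L g = \sum_l D_{v_l} D_{v_l} g + D_b g, the v_l being the
   columns of C. With C the coframe and b the [drift] below, this is the drift
   Laplacian Delta_f = Delta - <X^T, grad>. *)
Definition gen_at C b g y (c : R) : Prop :=
  exists (a d : 'I_m -> R) (a0 d0 : R),
    [/\ forall l, jet2 g y (frame_vec C l) (a l) (d l),
        jet2 g y b a0 d0 & c = \sum_l d l + a0].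

(** The drift only contributes a first derivative, which vanishes at a minimum. *)
Lemma gen_at_min C b g y c : (\forall z \near y, g y <= g z) ->
  gen_at C b g y c -> 0 <= c.
Proof.
move=> gmin [a [d [a0 [d0 [jg jb ->]]]]].
have [-> _] := jet2_min gmin jb.
by rewrite addr0; apply: sumr_ge0 => l _; have [] := jet2_min gmin (jg l).
Qed.

Lemma gen_atD C b g h y c c' : gen_at C b g y c -> gen_at C b h y c' ->
  gen_at C b (fun z => g z + h z) y (c + c').
Proof.
move=> [a [d [a0 [d0 [jg jb ->]]]]] [a' [d' [a0' [d0' [jh jb' ->]]]]].
exists (fun l => a l + a' l), (fun l => d l + d' l), (a0 + a0'), (d0 + d0').
split=> [l||]; [exact: jet2D|exact: jet2D|by rewrite big_split/= addrACA].
Qed.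

Lemma gen_atZ C b g (k : R) y c : gen_at C b g y c ->
  gen_at C b (fun z => k * g z) y (k * c).
Proof.
move=> [a [d [a0 [d0 [jg jb ->]]]]].
exists (fun l => k * a l), (fun l => k * d l), (k * a0), (k * d0).
split=> [l||]; [exact: jet2Z|exact: jet2Z|by rewrite mulrDr mulr_sumr].
Qed.

Lemma gen_at_cst C b (k : R) y : gen_at C b (cst k) y 0.
Proof.
exists (fun=> 0), (fun=> 0), 0, 0.
by split=> [l||]; [exact: jet2_cst|exact: jet2_cst|rewrite big1// addr0].
Qed.

End operator.

(** * The operator attached to an immersed parametrization *)

Section smooth_chart.
Variables (R : realType) (n m : nat) (U : set 'rV[R]_n).
Variable f : 'rV[R]_n -> 'rV[R]_m.
Hypotheses (oU : open U) (sf : smooth_on U f).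
Implicit Types (y v : 'rV[R]_n).

Let near_U y : U y -> \forall z \near y, U z.
Proof. by move=> Uy; apply: open_nbhs_nbhs. Qed.

Lemma smooth_differentiable y : U y -> differentiable f y.
Proof. exact: (@sf [::] y). Qed.

Lemma smooth_differentiable1 v y : U y -> differentiable ('D_v f) y.
Proof. exact: (@sf [:: v] y). Qed.

Lemma smooth_differentiable2 v w y : U y -> differentiable ('D_w ('D_v f)) y.
Proof. exact: (@sf [:: w; v] y). Qed.

Lemma derive_coord (g : 'rV[R]_n -> 'rV[R]_m) v y i : derivable g y v ->
  'D_v (fun z => g z 0 i) y = 'D_v g y 0 i.
Proof. by move=> dg; rewrite derive_mx// mxE. Qed.

Lemma jet2_coord y v i : U y ->
  jet2 (fun z => f z 0 i) y v ((v *m 'J f y) 0 i) ('D_v ('D_v f) y 0 i).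
Proof.
move=> Uy.
have df z : U z -> derivable f z v.
  by move=> Uz; exact/diff_derivable/smooth_differentiable.
split.
- apply: filterS (near_U Uy) => z Uz.
  by apply: (derivable_mxP f z v).1; exact: df.
- rewrite (derive_coord i (df y Uy)) deriveEjacobian//.
  exact: smooth_differentiable.
- have d2 : derivable ('D_v f) y v.
    exact/diff_derivable/smooth_differentiable1.
  rewrite -(derive_coord i d2).
  apply: (@near_eq_is_derive _ _ _ (fun z => 'D_v f z 0 i)).
    by apply: filterS (near_U Uy) => z Uz; rewrite (derive_coord i (df z Uz)).
  by apply: derivableP; apply: (derivable_mxP ('D_v f) y v).1.
Qed.

Lemma derive_delta_sum (g : 'rV[R]_n -> 'rV[R]_m) v y : differentiable g y ->
  'D_v g y = \sum_i v 0 i *: 'D_(delta_mx 0 i) g y.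
Proof.
move=> dg; rewrite deriveE// {1}(row_sum_delta v) linear_sum/=.
by apply: eq_bigr => i _; rewrite linearZ deriveE.
Qed.

Lemma derive2_delta_sum v y : U y ->
  'D_v ('D_v f) y = \sum_i \sum_j (v 0 i * v 0 j) *:
    'D_(delta_mx 0 i) (fun z => 'D_(delta_mx 0 j) f z) y.
Proof.
move=> Uy; rewrite derive_delta_sum; last exact: smooth_differentiable1.
apply: eq_bigr => i _.
(* The expansion of the inner derivative is known on U only, so it is substituted near y under the
   outer derivative. *)
rewrite (@near_eq_derive _ _ _ _
  (\sum_j (v 0 j *: 'D_(delta_mx 0 j) f))); last first.
  apply: filterS (near_U Uy) => z Uz.
  rewrite derive_delta_sum; last exact: smooth_differentiable.
  by rewrite fct_sumE.
rewrite derive_sum => [|j]; last first.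
  exact/derivableZ/diff_derivable/smooth_differentiable1.
rewrite scaler_sumr; apply: eq_bigr => j _.
rewrite deriveZ ?scalerA//.
exact/diff_derivable/smooth_differentiable1.
Qed.

Definition metric_inv y : 'M[R]_n := invmx (gram f y).

(** The trace of the coordinate Hessian, not of the covariant one: its tangential part carries the
    Christoffel terms, which [drift] removes. *)
Definition hess_trace y : 'rV[R]_m := \sum_i \sum_j
  metric_inv y i j *: 'D_(delta_mx 0 i) (fun z => 'D_(delta_mx 0 j) f z) y.

(** Coordinates of minus the tangential part of [hess_trace y + f y]: the Christoffel correction of
    the Laplacian together with -X^T. *)
Definition drift y : 'rV[R]_n :=
  - ((hess_trace y + f y) *m ('J f y)^T *m metric_inv y).

(* L X = H_f - X, by sum_derive2_frame below. *)
Lemma weighted_mean_curvatureE y :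
  weighted_mean_curvature f y - f y = hess_trace y + drift y *m 'J f y.
Proof.
rewrite /weighted_mean_curvature /mean_curvature /second_ff.
have npZ k (w : 'rV[R]_m) : k *: normal_part f y w = normal_part f y (k *: w).
  by rewrite /normal_part scalerBr !scalemxAl.
have npD w w' :
    normal_part f y (w + w') = normal_part f y w + normal_part f y w'.
  by rewrite /normal_part !mulmxDl opprD addrACA.
have np0 : normal_part f y 0 = 0 by rewrite /normal_part !mul0mx subr0.
have npS (I : finType) (F : I -> 'rV[R]_m) :
    \sum_i normal_part f y (F i) = normal_part f y (\sum_i F i).
  by rewrite (big_morph _ npD np0).
under eq_bigr => i _.
  under eq_bigr => j _ do rewrite npZ.
  rewrite npS; over.
rewrite npS -/(hess_trace y) -npD /normal_part.
rewrite /drift mulNmx -/(metric_inv y).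
move: (f y) (hess_trace y) (_ *m 'J f y) => x h t.
by apply/rowP => i; rewrite !mxE; ring.
Qed.

Hypothesis fJ : forall y, U y -> row_free ('J f y).

Let C y := coframe ('J f y).

Lemma sum_derive2_frame y : U y ->
  \sum_l 'D_(frame_vec (C y) l) ('D_(frame_vec (C y) l) f) y = hess_trace y.
Proof.
move=> Uy; under eq_bigr => l _ do rewrite derive2_delta_sum//.
rewrite exchange_big/=; apply: eq_bigr => i _.
rewrite exchange_big/=; apply: eq_bigr => j _.
rewrite -scaler_suml; congr (_ *: _).
rewrite /metric_inv /gram -coframe_mulmx_tr ?fJ// mxE.
by apply: eq_bigr => l _; rewrite !mxE.
Qed.

(* tangent_proj ('J f y) i i is |grad x_i|^2. *)
Lemma gen_at_sqnorm (P : pred 'I_m) y : U y ->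
  gen_at (C y) (drift y) (fun z => \sum_(i | P i) f z 0 i ^+ 2) y
    (2 * \sum_(i | P i) (tangent_proj ('J f y) i i +
       f y 0 i * (weighted_mean_curvature f y - f y) 0 i)).
Proof.
move=> Uy.
pose g1 v i := (v *m 'J f y) 0 i; pose g2 v i := 'D_v ('D_v f) y 0 i.
pose a v i := f y 0 i * g1 v i + f y 0 i * g1 v i.
pose d v i := f y 0 i * g2 v i + f y 0 i * g2 v i + 2 * g1 v i * g1 v i.
have jsq v i : jet2 (fun z => f z 0 i ^+ 2) y v (a v i) (d v i) :=
  jet2M (jet2_coord v i Uy) (jet2_coord v i Uy).
exists (fun l => \sum_(i | P i) a (frame_vec (C y) l) i),
  (fun l => \sum_(i | P i) d (frame_vec (C y) l) i),
  (\sum_(i | P i) a (drift y) i), (\sum_(i | P i) d (drift y) i); split.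
- by move=> l; apply: jet2_sum => i _; exact: jsq.
- by apply: jet2_sum => i _; exact: jsq.
rewrite /a /d /g1 /g2.
rewrite exchange_big/= -big_split/= mulr_sumr; apply: eq_bigr => i _.
have -> : (weighted_mean_curvature f y - f y) 0 i =
    \sum_l 'D_(frame_vec (C y) l) ('D_(frame_vec (C y) l) f) y 0 i +
    (drift y *m 'J f y) 0 i.
  by rewrite weighted_mean_curvatureE [LHS]mxE -(sum_derive2_frame Uy) summxE.
(* The terms 2 (D_{v_l} x_i)^2 of the product rule add up over l to twice the i-th diagonal entry of
   the projection. *)
rewrite -(tangent_proj_diag i (fJ Uy)) -tangent_proj_tr -/(C y).
have E l : (frame_vec (C y) l *m 'J f y) 0 i = ((C y)^T *m 'J f y) l i.
  by rewrite /frame_vec -row_mul mxE.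
under eq_bigr => l _ do rewrite E.
rewrite !big_split/= -!mulr_sumr.
under [X in _ = _ + X + _]eq_bigr do rewrite -mulrA -expr2.
rewrite -mulr_sumr.
ring.
Qed.

Lemma entrywise_continuous_jacobian y : U y ->
  entrywise_continuous_at y (fun z => 'J f z).
Proof.
move=> Uy i j.
have cD : {for y, continuous (fun z => 'D_(delta_mx 0 i) f z 0 j)}.
  apply: (@continuous_comp _ _ _ _ (fun M : 'rV[R]_m => M 0 j)).
    exact/differentiable_continuous/smooth_differentiable1.
  exact: coord_continuous.
have E z : U z -> 'D_(delta_mx 0 i) f z 0 j = 'J f z i j.
  move=> Uz; rewrite deriveEjacobian; last exact: smooth_differentiable.
  by rewrite -rowE mxE.
have nE : \forall z \near y, 'D_(delta_mx 0 i) f z 0 j = 'J f z i j.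
  by apply: filterS (near_U Uy) => z; exact: E.
suff : 'D_(delta_mx 0 i) f z 0 j @[z --> y] --> 'J f y i j.
  by apply: cvg_trans; exact: near_eq_cvg nE.
by rewrite -(E y Uy).
Qed.

Lemma entrywise_continuous_metric_inv y : U y ->
  entrywise_continuous_at y metric_inv.
Proof.
move=> Uy; apply: entrywise_continuous_invmx; first exact/mulmx_tr_unit/fJ.
apply: entrywise_continuous_mul; first exact: entrywise_continuous_jacobian.
exact/entrywise_continuous_tr/entrywise_continuous_jacobian.
Qed.

Lemma entrywise_continuous_coframe y : U y -> entrywise_continuous_at y C.
Proof.
move=> Uy; apply: entrywise_continuous_mul.
  exact: entrywise_continuous_metric_inv.
exact: entrywise_continuous_jacobian.
Qed.

Lemma entrywise_continuous_chart y : U y -> entrywise_continuous_at y f.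
Proof.
move=> Uy i j; apply: (@continuous_comp _ _ _ f (fun M : 'rV[R]_m => M i j)).
  exact/differentiable_continuous/smooth_differentiable.
exact: coord_continuous.
Qed.

Lemma entrywise_continuous_drift y : U y -> entrywise_continuous_at y drift.
Proof.
move=> Uy; apply: entrywise_continuous_opp.
apply: entrywise_continuous_mul; last exact: entrywise_continuous_metric_inv.
apply: entrywise_continuous_mul; last first.
  exact/entrywise_continuous_tr/entrywise_continuous_jacobian.
apply: entrywise_continuous_add; last exact: entrywise_continuous_chart.
move=> i j.
have E z : hess_trace z i j = \sum_k \sum_l metric_inv z k l *
    'D_(delta_mx 0 k) (fun z => 'D_(delta_mx 0 l) f z) z i j.
  rewrite summxE; apply: eq_bigr => k _; rewrite summxE.
  by apply: eq_bigr => l _; rewrite mxE.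
apply: (eq_continuous_at E).
apply: continuous_at_sum => k _; apply: continuous_at_sum => l _.
have c1 : {for y, continuous (fun z => metric_inv z k l)}.
  by have cm := entrywise_continuous_metric_inv Uy; exact: cm.
have c2 : {for y, continuous (fun z =>
    'D_(delta_mx 0 k) (fun z => 'D_(delta_mx 0 l) f z) z i j)}.
  apply: (@continuous_comp _ _ _ _ (fun M : 'rV[R]_m => M i j)).
    exact/differentiable_continuous/smooth_differentiable2.
  exact: coord_continuous.
exact: cvgM c1 c2.
Qed.

End smooth_chart.

(** * Euclidean balls and barriers *)

Section euclidean_topology.
Variables (R : realType) (n : nat).
Implicit Types y z c : 'rV[R]_n.

Definition sqdist y z : R := edot (y - z) (y - z).

Lemma sqdist_ge0 y z : 0 <= sqdist y z. Proof. exact: edot_ge0. Qed.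

Lemma sqdistxx y : sqdist y y = 0.
Proof. by rewrite /sqdist subrr /edot big1// => i _; rewrite mxE mul0r. Qed.

Lemma sqdistE y z : sqdist y z = \sum_i (y 0 i - z 0 i) ^+ 2.
Proof. by apply: eq_bigr => i _; rewrite !mxE expr2. Qed.

(** Replaces the triangle inequality for squared distances; the two sides differ by |y - 2 c +
    z|^2. *)
Lemma sqdist_le_double y z c :
  sqdist y z <= 2 * sqdist y c + 2 * sqdist c z.
Proof.
rewrite !sqdistE !mulr_sumr -big_split/=; apply: ler_sum => i _.
rewrite -subr_ge0.
have -> : 2 * (y 0 i - c 0 i) ^+ 2 + 2 * (c 0 i - z 0 i) ^+ 2 -
   (y 0 i - z 0 i) ^+ 2 = (y 0 i - 2 * c 0 i + z 0 i) ^+ 2 by ring.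
exact: sqr_ge0.
Qed.

Lemma sqdist_continuous c : continuous (sqdist^~ c).
Proof.
move=> y; apply: eq_continuous_at => [z|]; first exact: sqdistE.
apply: continuous_at_sum => i _.
have c1 : {for y, continuous (fun z : 'rV[R]_n => z 0 i - c 0 i)}.
  have c0 : {for y, continuous (fun z : 'rV[R]_n => z 0 i)}.
    exact: coord_continuous.
  exact: cvgB c0 (cvg_cst (c 0 i)).
exact: (cvgM c1 c1).
Qed.

Lemma near_sqdist c k y : sqdist y c < k -> \forall z \near y, sqdist z c < k.
Proof. by move=> yk; exact: (cvgr_lt _ (@sqdist_continuous c y) _ yk). Qed.

Lemma near_sqdistP y (P : 'rV[R]_n -> Prop) : (\forall z \near y, P z) ->
  exists2 d : R, 0 < d & forall z, sqdist z y <= d -> P z.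
Proof.
move=> /nbhs_ballP[e /= e0 eP]; exists ((e / 2) ^+ 2).
  by rewrite exprn_gt0// divr_gt0.
move=> z zy; apply: eP; split=> // i j; rewrite ord1 /ball/= distrC.
apply: (@le_lt_trans _ _ (e / 2)); last first.
  by rewrite ltr_pdivrMr// ltr_pMr// ltr1n.
rewrite -(ler_pXn2r (n := 2))// ?nnegrE ?divr_ge0 ?(ltW e0)//.
rewrite (le_trans _ zy)// real_normK ?num_real// sqdistE (bigD1 j)//=.
by rewrite lerDl; apply: sumr_ge0 => k _; exact: sqr_ge0.
Qed.

Lemma compact_sqdist_le c k : compact [set z | sqdist z c <= k].
Proof.
apply: bounded_closed_compact.
  exists (Num.sqrt k + `|c|); split; first exact: num_real.
  move=> M kM z /= zk; apply/ltW/(le_lt_trans _ kM).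
  rewrite -(subrK c z) (le_trans (ler_normD _ _))// lerD2r.
  rewrite [leLHS]/Num.Def.normr/= mx_normrE bigmax_le ?sqrtr_ge0//.
  move=> [i j] _ /=.
  rewrite ord1 -sqrtr_sqr ler_wsqrtr// (le_trans _ zk)// sqdistE (bigD1 j)//=.
  by rewrite !mxE lerDl; apply: sumr_ge0 => l _; exact: sqr_ge0.
have -> : [set z | sqdist z c <= k] = (sqdist^~ c) @^-1` [set x | x <= k] by [].
apply: preimage_closed; last exact: closed_le.
by move=> x _; exact: sqdist_continuous.
Qed.

End euclidean_topology.

Lemma compact_pos_lbound (R : realType) (T : topologicalType) (A : set T)
    (w : T -> R) : compact A -> {in A, continuous w} ->
  (forall x, A x -> 0 < w x) -> exists2 k, 0 < k & forall x, A x -> k <= w x.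
Proof.
move=> cA cw wpos; have [A0|A0] := pselect (A !=set0); last first.
  by exists 1 => // x Ax; exfalso; apply: A0; exists x.
have [x xA xmin] := compact_EVT_min A0 cA (continuous_in_subspaceT cw).
exists (w x); first by apply: wpos; rewrite inE in xA.
by move=> z Az; apply: xmin; rewrite inE.
Qed.

(** * A quadratic barrier *)

Section barrier.
Variables (R : realType) (n m : nat).
Implicit Types (y v c : 'rV[R]_n) (C : 'M[R]_(n, m)).

Definition defect (k : R) c y : R := k - sqdist y c.

(* Since [defect] vanishes on the sphere of squared radius k about c, a large
   beta makes L [barrier] positive near the sphere without changing the sign of
   [defect] there. *)
Definition barrier (k : R) c (beta : R) y : R :=
  defect k c y + beta * defect k c y ^+ 2.

Lemma jet2_linear_coord y v i : jet2 (fun z : 'rV[R]_n => z 0 i) y v (v 0 i) 0.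
Proof.
have di z : derivable (fun z : 'rV[R]_n => z) z v by exact: derivable_id.
have E z : 'D_v (fun z : 'rV[R]_n => z 0 i) z = v 0 i.
  by rewrite (derive_coord i (di z)) derive_id.
have Ec : 'D_v (fun z : 'rV[R]_n => z 0 i) = cst (v 0 i).
  by apply/funext => z; rewrite E.
split=> //; last by rewrite Ec; exact: is_derive_cst.
by near=> z; apply: (derivable_mxP (fun z => z) z v).1; exact: di.
Unshelve. all: by end_near. Qed.

Lemma jet2_defect k c y v : jet2 (defect k c) y v
  (- 2 * edot (y - c) v) (- 2 * edot v v).
Proof.
have jx i : jet2 (fun z : 'rV[R]_n => z 0 i - c 0 i) y v (v 0 i) 0.
  have := jet2D (jet2_linear_coord y v i) (jet2_cst (- c 0 i) y v).
  by rewrite !addr0.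
have jq := jet2_sum (index_enum _) (P := xpredT)
  (fun i _ => jet2M (jx i) (jx i)).
have := jet2D (jet2_cst k y v) (jet2Z (-1) jq).
have -> : (cst k + (fun z : 'rV[R]_n => -1 * \sum_i
    ((fun z => z 0 i - c 0 i) * (fun z => z 0 i - c 0 i)) z)) = defect k c.
  apply/funext => z.
  change (k + -1 * (\sum_i (z 0 i - c 0 i) * (z 0 i - c 0 i)) = defect k c z).
  by rewrite mulN1r /defect sqdistE.
congr jet2.
  rewrite add0r /edot !mulr_sumr; apply: eq_bigr => i _; rewrite !mxE; ring.
rewrite add0r /edot !mulr_sumr; apply: eq_bigr => i _; ring.
Qed.

(** The chain rule phi'(D) L D + phi''(D) |grad D|^2 for phi(D) = D + beta D^2 and D = [defect k c],
    with phi'' = 2 beta and |grad D|^2 = 4 |(y - c) C|^2. *)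
Definition barrier_gen (k : R) c (beta : R) C (b : 'rV[R]_n) y : R :=
  (1 + 2 * beta * defect k c y) * (- 2 * \tr (C *m C^T) - 2 * edot (y - c) b)
  + 8 * beta * edot ((y - c) *m C) ((y - c) *m C).

Lemma gen_at_barrier k c beta C b y :
  gen_at C b (barrier k c beta) y (barrier_gen k c beta C b y).
Proof.
pose D := defect k c y.
pose a v := - 2 * edot (y - c) v; pose d v := - 2 * edot v v.
have jb v : jet2 (barrier k c beta) y v (a v + beta * (D * a v + D * a v))
    (d v + beta * (D * d v + D * d v + 2 * a v * a v)).
  have jd := jet2_defect k c y v.
  exact: jet2D jd (jet2Z beta (jet2M jd jd)).
pose v l := frame_vec C l.
exists (fun l => a (v l) + beta * (D * a (v l) + D * a (v l))).
exists (fun l => d (v l) +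
  beta * (D * d (v l) + D * d (v l) + 2 * a (v l) * a (v l))).
eexists _, _; split=> [l||]; [exact: jb|exact: jb b|].
have E1 : \tr (C *m C^T) = \sum_l edot (v l) (v l).
  rewrite mxtrace_mulC; apply: eq_bigr => l _; rewrite mxE.
  by apply: eq_bigr => i _; rewrite !mxE.
have E2 : edot ((y - c) *m C) ((y - c) *m C) =
    \sum_l edot (y - c) (v l) ^+ 2.
  apply: eq_bigr => l _; rewrite -expr2 [in LHS]mxE; congr (_ ^+ 2).
  by apply: eq_bigr => i _; rewrite !mxE.
rewrite /barrier_gen -/D E1 E2.
have E3 l : d (v l) + beta * (D * d (v l) +
    D * d (v l) + 2 * a (v l) * a (v l)) =
    (1 + 2 * beta * D) * (- 2) * edot (v l) (v l)
     + 8 * beta * edot (y - c) (v l) ^+ 2.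
  by rewrite /a /d; ring.
under [in RHS]eq_bigr do rewrite E3.
rewrite big_split/= -!mulr_sumr /a.
ring.
Qed.

Lemma barrier_gen_continuous k c beta (C : 'rV[R]_n -> 'M[R]_(n, m)) b y :
  entrywise_continuous_at y C -> entrywise_continuous_at y b ->
  {for y, continuous (fun z => barrier_gen k c beta (C z) (b z) z)}.
Proof.
move=> cC cb.
have cD : {for y, continuous (defect k c)}.
  exact: (cvgB (cvg_cst k) (@sqdist_continuous _ _ c y)).
have cyc : entrywise_continuous_at y (fun z => z - c).
  apply: entrywise_continuous_add; last exact: entrywise_continuous_cst.
  by move=> i j; exact: coord_continuous.
have cdot (p : nat) (u v : 'rV[R]_n -> 'rV[R]_p) :
    entrywise_continuous_at y u -> entrywise_continuous_at y v ->
    {for y, continuous (fun z => edot (u z) (v z))}.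
  move=> cu cv; apply: continuous_at_sum => i _.
  exact: cvgM (cu 0 i) (cv 0 i).
have ct : {for y, continuous (fun z => \tr (C z *m (C z)^T))}.
  apply: continuous_at_sum => i _.
  exact: (entrywise_continuous_mul cC (entrywise_continuous_tr cC)).
have cYC := entrywise_continuous_mul cyc cC.
have k0 (x : R) : {for y, continuous (fun _ : 'rV[R]_n => x)}.
  exact: cst_continuous.
apply: continuous_atD; apply: continuous_atM.
- by apply: continuous_atD => //; apply: continuous_atM.
- apply: continuous_atB; apply: continuous_atM => //.
  exact: cdot.
- exact: k0.
- exact: cdot.
Qed.

End barrier.

(** * The strong minimum principle *)

Section strong_minimum_principle.
Variables (R : realType) (n m : nat).
Variables (w : 'rV[R]_n -> R) (C : 'rV[R]_n -> 'M[R]_(n, m)).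
Variable b : 'rV[R]_n -> 'rV[R]_n.

(** A condition at one point, so that it can be asked on a neighborhood only. The clause on [z] is
    ellipticity; the last one says L w <= 0. *)
Definition supersolution_at y : Prop :=
  [/\ 0 <= w y, {for y, continuous w}, entrywise_continuous_at y C,
      entrywise_continuous_at y b &
      (forall z : 'rV[R]_n, z *m C y = 0 -> z = 0) /\
      exists2 c, c <= 0 & gen_at (C y) (b y) w y c].

(* y2 is the zero of w closest to y1 and c is the midpoint of y1 and y2, so that
   the ball about c touches the zero set at y2 only. *)
Lemma barrier_contact y0 (d : R) : 0 < d ->
  (forall z, sqdist z y0 <= d -> supersolution_at z) -> w y0 = 0 ->
  forall y1, sqdist y1 y0 <= d / 16 -> w y1 != 0 ->
  exists y2 c, [/\ y2 != c, sqdist y2 y0 < d, w y2 = 0 &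
    forall z, sqdist z y0 <= d -> w z = 0 ->
      defect (sqdist y2 c) c z <= - (sqdist z y2) / 2].
Proof.
move=> d0 good w0 y1 y1d wy1.
pose Z := [set z | sqdist z y0 <= d /\ w z = 0].
have cZ : compact Z.
  (* [w] is known to be continuous only at points of the closed ball, so a limit point is first
     placed in that ball. *)
  have clZ : closed Z.
    move=> z zZ; have zd : sqdist z y0 <= d.
      rewrite leNgt; apply/negP => dz.
      have nz : \forall t \near z, d < sqdist t y0.
        exact: (cvgr_gt _ (@sqdist_continuous _ _ y0 z) _ dz).
      by have [t [[td _]]] := zZ _ nz; rewrite ltNge td.
    split=> //; apply/eqP; apply: contrapT => /negP wz.
    have [_ cw _ _ _] := good z zd.
    have nz : \forall t \near z, w t != 0 by exact: (cvgr_neq0 _ cw wz).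
    by have [t [[_ ->]]] := zZ _ nz; rewrite eqxx.
  by apply: (subclosed_compact clZ (@compact_sqdist_le _ _ y0 d)) => z [].
have Zy0 : Z y0 by split; rewrite ?sqdistxx ?(ltW d0).
have [y2 /[!inE] -[y2d wy2] y2min] := compact_EVT_min (ex_intro _ _ Zy0) cZ
  (continuous_subspaceT (@sqdist_continuous _ _ y1)).
have sC u v : sqdist u v = sqdist v u :> R.
  by rewrite !sqdistE; apply: eq_bigr => i _; ring.
have m21 : sqdist y2 y1 <= d / 16.
  by have := y2min y0; rewrite inE => /(_ Zy0) /le_trans; apply; rewrite sC.
pose c := 2^-1 *: (y1 + y2).
have y12 : y1 != y2 by apply: contra_neq wy1 => ->.
exists y2, c; split=> //.
- apply: contra_neq y12 => y2c; apply/rowP => i.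
  have := congr1 (fun u : 'rV[R]_n => u 0 i) y2c; rewrite !mxE; lra.
(* Since [y0] is itself a zero, [y2] is as close to [y1] as [y0] is; the bound obtained is 4 (d /
   16) = d / 4. *)
- have := sqdist_le_double y2 y0 y1; lra.
move=> z zd wz.
have : sqdist y2 y1 <= sqdist z y1 by apply: y2min; rewrite inE.
(* Apollonius' identity for the midpoint [c]. The excess |z - y2|^2 / 2 makes the contact strict
   away from [y2]. *)
have : sqdist z c =
    2^-1 * sqdist z y1 + 2^-1 * sqdist z y2 - 4^-1 * sqdist y2 y1.
  rewrite !sqdistE !mulr_sumr -big_split -sumrB/=.
  by apply: eq_bigr => i _; rewrite /c !mxE; field.
have : sqdist y2 c = 4^-1 * sqdist y2 y1.
  rewrite !sqdistE !mulr_sumr; apply: eq_bigr => i _; rewrite /c !mxE.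
  by field.
rewrite /defect; lra.
Qed.

(** On a small ball around [y2], L [barrier] > 0 and L w <= 0, so w - eta [barrier] has no interior
    minimum. It vanishes at the center [y2] and, for small eta, is positive on the boundary: a
    contradiction. As the ball surrounds [y2], no normal derivative has to be compared. *)
Lemma no_barrier_contact y0 (d : R) y2 c : 
  (forall z, sqdist z y0 <= d -> supersolution_at z) ->
  y2 != c -> sqdist y2 y0 < d -> w y2 = 0 ->
  (forall z, sqdist z y0 <= d -> w z = 0 ->
      defect (sqdist y2 c) c z <= - (sqdist z y2) / 2) -> False.
Proof.
move=> good y2c y2d wy2 ext.
pose k := sqdist y2 c; have k0 : 0 <= k by exact: sqdist_ge0.
have [_ _ cC cb [injC _]] := good _ (ltW y2d).
pose S := edot ((y2 - c) *m C y2) ((y2 - c) *m C y2).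
have S0 : 0 < S.
  rewrite lt_neqAle edot_ge0 andbT eq_sym; apply: contra_neq y2c => S0.
  by apply/subr0_eq/injC; exact: edot_eq0.
pose q := - 2 * \tr (C y2 *m (C y2)^T) - 2 * edot (y2 - c) (b y2).
(* At [y2] the defect is 0, so L [barrier] = q + 8 beta S, which this choice makes at least 1. *)
pose beta := (`|q| + 1) / (8 * S).
have beta0 : 0 < beta by rewrite divr_gt0 ?mulr_gt0// ltr_pwDr.
pose G z := barrier_gen k c beta (C z) (b z) z.
have Gy2 : 0 < G y2.
  rewrite /G /barrier_gen /defect subrr mulr0 addr0 mul1r -/q -/S.
  have -> : 8 * beta * S = `|q| + 1 by rewrite /beta; field; rewrite gt_eqF.
  by have := ler_norm (- q); rewrite normrN; lra.
have : \forall z \near y2, [/\ 0 < G z, 0 < 1 + beta * defect k c z &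
    sqdist z y0 < d].
  have n1 : \forall z \near y2, 0 < G z.
    have cG : {for y2, continuous G} by exact: barrier_gen_continuous.
    exact: (cvgr_gt _ cG _ Gy2).
  have n2 : \forall z \near y2, 0 < 1 + beta * defect k c z.
    have cD : {for y2, continuous (fun z => 1 + beta * defect k c z)}.
      apply: continuous_atD; first exact: cst_continuous.
      apply: continuous_atM; first exact: cst_continuous.
      apply: continuous_atB; first exact: cst_continuous.
      exact: sqdist_continuous.
    apply: (cvgr_gt _ cD).
    by rewrite /defect subrr mulr0 addr0.
  by apply: filterS3 n1 n2 (near_sqdist y2d) => z; split.
move=> /near_sqdistP[rho rho0 near_y2].
have gz z : sqdist z y2 <= rho -> supersolution_at z.
  by move=> /near_y2[_ _ /ltW]; exact: good.
(* The part of the small sphere where the defect is nonnegative. A zero of [w] on that sphere has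
   defect at most - rho / 2, so [w] > 0 on this compact set. *)
pose A := [set z | sqdist z y2 <= rho] `&`
  ([set z : 'rV[R]_n | rho <= sqdist z y2] `&` [set z | 0 <= defect k c z]).
have cA : compact A.
  apply: compact_closedI (@compact_sqdist_le _ _ y2 rho) _.
  apply: closedI.
    have -> : [set z : 'rV[R]_n | rho <= sqdist z y2] =
      (fun z => sqdist z y2) @^-1` [set x : R | rho <= x] by [].
    apply: preimage_closed; last exact: closed_ge.
    by move=> x _; exact: sqdist_continuous.
  have -> : [set z : 'rV[R]_n | 0 <= defect k c z] =
      (fun z => sqdist z c) @^-1` [set x : R | x <= k].
    by apply/seteqP; split=> z /=; rewrite /defect subr_ge0.
  apply: preimage_closed; last exact: closed_le.
  by move=> x _; exact: sqdist_continuous.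
have [mu mu0 muA] : exists2 mu, 0 < mu & forall z, A z -> mu <= w z.
  apply: (compact_pos_lbound cA) => z.
    by rewrite inE => -[/gz[]].
  move=> [/= z1 [/= z2 /= z3]]; have [wz0 _ _ _ _] := gz z z1.
  rewrite lt_neqAle wz0 andbT eq_sym; apply/eqP => wz.
  have [_ _ /ltW zd] := near_y2 z z1.
  have := ext z zd wz; rewrite -/k; lra.
(* Upper bound of the barrier where its defect lies in [0, k]; [eta] is then small enough for eta H
   < mu. *)
pose H := k * (1 + beta * k); have H0 : 0 <= H.
  by rewrite mulr_ge0// addr_ge0// mulr_ge0// ltW.
pose eta := mu / (H + 1).
have eta0 : 0 < eta by rewrite divr_gt0// ltr_pwDr.
have etaH : eta * H < mu.
  by rewrite /eta mulrAC ltr_pdivrMr ?ltr_pM2l// ?ltrDl//; lra.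
have bE z : barrier k c beta z = defect k c z * (1 + beta * defect k c z).
  by rewrite /barrier; ring.
pose g z := w z + - eta * barrier k c beta z.
have gy2 : g y2 = 0.
  by rewrite /g wy2 bE /defect subrr mul0r mulr0 addr0.
have [zs /[!inE] zs_rho zmin] :
    exists2 zs, zs \in [set z | sqdist z y2 <= rho] &
    forall z, z \in [set z | sqdist z y2 <= rho] -> g zs <= g z.
  apply: compact_EVT_min.
  - by exists y2; rewrite /= sqdistxx ltW.
  - exact: compact_sqdist_le.
  apply: continuous_in_subspaceT => z; rewrite inE => /gz[_ cw _ _ _].
  have cD : {for z, continuous (defect k c)}.
    by apply: continuous_atB; [exact: cst_continuous|exact: sqdist_continuous].
  suff : {for z, continuous (fun z => w z + - eta *
    (defect k c z + beta * (defect k c z * defect k c z)))} by [].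
  apply: continuous_atD => //.
  apply: continuous_atM; first exact: cst_continuous.
  apply: continuous_atD => //.
  apply: continuous_atM; first exact: cst_continuous.
  exact: continuous_atM.
have gzs : g zs <= 0.
  by rewrite -gy2; apply: zmin; rewrite inE/= sqdistxx ltW.
have [G0 pos _] := near_y2 zs zs_rho.
have [wzs _ _ _ [_ [cw cw0 gw]]] := gz zs zs_rho.
(* On the sphere w - eta [barrier] is positive: by [mu] if the defect is nonnegative, and otherwise
   because [barrier] < 0 <= [w]. Yet its minimum is at most 0. *)
have zs_int : sqdist zs y2 < rho.
  rewrite ltNge; apply/negP => zs_ge.
  have [D0|D0] := leP 0 (defect k c zs).
    have wmu : mu <= w zs by exact: muA.
    have : barrier k c beta zs <= H.
      rewrite bE; have Dk : defect k c zs <= k.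
        by rewrite /defect gerBl sqdist_ge0.
      by apply: ler_pM => //; [exact: ltW|rewrite lerD2l ler_pM2l].
    move: gzs; rewrite /g; nra.
  have : barrier k c beta zs < 0 by rewrite bE nmulr_rlt0.
  move: gzs; rewrite /g; nra.
have locmin : \forall z \near zs, g zs <= g z.
  by apply: filterS (near_sqdist zs_int) => z /ltW zr; apply: zmin; rewrite inE.
have := gen_at_min locmin (gen_atD gw (gen_atZ (- eta)
  (gen_at_barrier k c beta (C zs) (b zs) zs))).
rewrite -/(G zs); nra.
Qed.

Lemma strong_minimum_principle y0 :
  (\forall y \near y0, supersolution_at y) -> w y0 = 0 ->
  \forall y \near y0, w y = 0.
Proof.
move=> /near_sqdistP[d d0 good] w0.
have d16 : sqdist y0 y0 < d / 16 by rewrite sqdistxx divr_gt0.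
apply: filterS (near_sqdist d16) => y1 /ltW y1d; apply/eqP.
apply: contrapT => /negP wy1.
have [y2 [c [y2c y2d wy2 ext]]] := barrier_contact d0 good w0 y1d wy1.
exact: no_barrier_contact good y2c y2d wy2 ext.
Qed.

End strong_minimum_principle.

(** * Submanifolds inside a cylinder *)

Section split_coords_lemmas.
Variables (R : realType) (N a b : nat) (e : N = (a + b)%N).

Lemma edot_split_coords (X : 'rV[R]_N) :
  edot (split_coords e X).1 (split_coords e X).1 =
  \sum_(i < N | (i < a)%N) X 0 i ^+ 2.
Proof.
subst N; rewrite /split_coords castmx_id/= big_mkcond big_split_ord/=.
rewrite [X in _ = _ + X]big1 ?addr0 => [|i _]; last by rewrite ltnNge leq_addr.
by apply: eq_bigr => i _; rewrite mxE ltn_ord expr2.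
Qed.

Lemma card_split_coords : #|[pred i : 'I_N | ~~ (i < a)%N]| = b.
Proof.
subst N; rewrite -sum1_card big_mkcond big_split_ord/=.
rewrite big1 ?add0n => [|i _]; last by rewrite inE/= ltn_ord.
under eq_bigr do rewrite inE/= -leqNgt leq_addr.
by rewrite sum1_card card_ord.
Qed.

End split_coords_lemmas.

Section chart_lemmas.
Variables (R : realType) (n : nat) (M : topologicalType) (c : chart R n M).

Lemma near_param (x : M) (Q : M -> Prop) : chart_dom c x ->
  (\forall x' \near x, Q x') -> \forall y \near Defs.coord c x, Q (param c y).
Proof.
move=> cx nQ; have := @param_continuous _ _ _ c.
rewrite continuous_open_subspace; last exact: codom_open.
move=> /(_ (Defs.coord c x)); rewrite inE => /(_ (imageP _ cx)).
by rewrite /continuous_at coordK//; apply.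
Qed.

Lemma near_coord (x : M) (Q : 'rV[R]_n -> Prop) : chart_dom c x ->
  (\forall y \near Defs.coord c x, Q y) ->
  \forall x' \near x, chart_dom c x' /\ Q (Defs.coord c x').
Proof.
move=> cx nQ; have := @Defs.coord_continuous _ _ _ c.
rewrite continuous_open_subspace; last exact: dom_open.
move=> /(_ x); rewrite inE => /(_ cx) cc.
have nd : \forall x' \near x, chart_dom c x'.
  by apply: open_nbhs_nbhs; split=> //; exact: dom_open.
by apply: filterS2 nd (cc _ nQ).
Qed.

End chart_lemmas.

(** * Bounds on L |u|^2 and L |X|^2 *)

Section lambda_submanifold_estimates.
Variables (R : realType) (n m : nat) (lambda : R) (lambda_ge0 : 0 <= lambda).
Variables (M : topologicalType) (A : set (chart R n M)) (F : M -> 'rV[R]_m).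
Hypothesis F_immersion : smooth_immersion A F.
Hypothesis F_lambda : lambda_submanifold A F lambda.
Variables (c : chart R n M) (Ac : A c).
Let f := F \o param c.

(** With a predicate on coordinates, one estimate serves both |u|^2 (the first k+1 coordinates) and
    |X|^2 ([predT]). *)
Definition partial_sqnorm (P : pred 'I_m) (X : 'rV[R]_m) : R :=
  \sum_(i | P i) X 0 i ^+ 2.

Lemma partial_sqnorm_ge0 P X : 0 <= partial_sqnorm P X.
Proof. by apply: sumr_ge0 => i _; exact: sqr_ge0. Qed.


(** Cauchy-Schwarz on the coordinates in [P] bounds the H_f term by lambda s, and the diagonal of
    the projection summed over [P] lies between n minus the number of other coordinates and n. *)
Lemma gen_at_partial_sqnorm (P : pred 'I_m) y : chart_codom c y ->
  exists2 a : R,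
    gen_at (coframe ('J f y)) (drift f y) (partial_sqnorm P \o f) y (2 * a) &
    let s := Num.sqrt (partial_sqnorm P (f y)) in
    n%:R - #|[pred i | ~~ P i]|%:R - lambda * s - s ^+ 2 <= a <=
    n%:R + lambda * s - s ^+ 2.
Proof.
move=> cy; have [sf fJ] := F_immersion Ac.
have oU : open (chart_codom c) by exact: codom_open.
eexists; first exact: (gen_at_sqnorm oU sf fJ P cy).
move=> s; have fJy := fJ y cy.
set h := weighted_mean_curvature f y.
have hl : edot h h = lambda ^+ 2.
  have [x cx xy] := cy; have := F_lambda Ac cx.
  by rewrite xy -/f -/h => <-; rewrite enormK.
have s2 : \sum_(i | P i) f y 0 i ^+ 2 = s ^+ 2.
  by rewrite sqr_sqrtr ?partial_sqnorm_ge0.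
have CS : `|\sum_(i | P i) f y 0 i * h 0 i| <= lambda * s.
  apply: le_trans (ler_sum_cauchy_schwarz P (fun i => f y 0 i) (h 0)) _.
  rewrite mulrC -/s ler_wpM2r ?sqrtr_ge0//.
  rewrite -[leRHS]ger0_norm// -sqrtr_sqr ler_wsqrtr// -hl /edot.
  rewrite [leRHS](bigID P)/= [leLHS](eq_bigr (fun i => h 0 i * h 0 i));
    last by move=> i _; exact: expr2.
  by rewrite lerDl; apply: sumr_ge0 => i _; rewrite -expr2 sqr_ge0.
have -> : \sum_(i | P i) (tangent_proj ('J f y) i i +
    f y 0 i * (h - f y) 0 i) = \sum_(i | P i) tangent_proj ('J f y) i i +
    \sum_(i | P i) f y 0 i * h 0 i - s ^+ 2.
  rewrite -s2 -big_split -sumrB/=; apply: eq_bigr => i _.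
  by rewrite [X in _ * X]mxE [X in _ * (_ + X)]mxE; ring.
have lo := tangent_proj_diag_sum_ge P fJy.
have hi : \sum_(i | P i) tangent_proj ('J f y) i i <= n%:R.
  rewrite -(tangent_proj_trace fJy) [leRHS](bigID P)/= lerDl.
  by apply: sumr_ge0 => i _; exact: tangent_proj_diag_ge0.
have := ler_normlW CS; have := lerNnormlW CS; lra.
Qed.

Lemma supersolution_partial_sqnorm (P : pred 'I_m) (r : R) y :
  chart_codom c y -> 0 <= r ->
  r ^+ 2 + lambda * r = n%:R - #|[pred i | ~~ P i]|%:R ->
  partial_sqnorm P (f y) <= r ^+ 2 ->
  supersolution_at (fun z => r ^+ 2 - partial_sqnorm P (f z))
    (fun z => coframe ('J f z)) (drift f) y.
Proof.
move=> cy r0 rE sr; have [sf fJ] := F_immersion Ac.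
have oU : open (chart_codom c) by exact: codom_open.
split; last split.
- by rewrite subr_ge0.
- apply: continuous_atB; first exact: cst_continuous.
  apply: continuous_at_sum => i _; apply: continuous_atM;
  exact: (entrywise_continuous_chart sf cy).
- exact: (entrywise_continuous_coframe oU sf fJ cy).
- exact: (entrywise_continuous_drift oU sf fJ cy).
- by move=> z; apply: coframe_inj; exact: fJ.
have [a ga /andP[ale _]] := gen_at_partial_sqnorm P cy.
exists (0 + -1 * (2 * a)); last first.
  have -> : (fun z => r ^+ 2 - partial_sqnorm P (f z)) =
      (fun z => cst (r ^+ 2) z + -1 * (partial_sqnorm P \o f) z).
    by apply/funext => z; rewrite mulN1r.
  exact: gen_atD (gen_at_cst _ _ _ _) (gen_atZ _ ga).
rewrite add0r mulN1r oppr_le0 mulr_ge0//.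
apply: le_trans ale; rewrite -rE.
have s0 := sqrtr_ge0 (partial_sqnorm P (f y)).
have : Num.sqrt (partial_sqnorm P (f y)) <= r.
  by rewrite -[r]ger0_norm// -sqrtr_sqr ler_wsqrtr.
move: s0; move: (Num.sqrt _) => s s0 s_r.
have -> : r ^+ 2 + lambda * r - lambda * s - s ^+ 2 =
    (r - s) * (r + s + lambda) by ring.
by rewrite mulr_ge0 ?subr_ge0 ?addr_ge0.
Qed.

End lambda_submanifold_estimates.

(** * Excluding points with |u| < r *)

Section cylinder.
Variables (R : realType) (n m : nat) (lambda : R) (lambda_ge0 : 0 <= lambda).
Variables (M : topologicalType) (A : set (chart R n M)) (F : M -> 'rV[R]_m).
Hypothesis A_cover : forall x : M, exists2 c, A c & chart_dom c x.
Hypothesis F_immersion : smooth_immersion A F.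
Hypothesis F_proper : proper_map F.
Hypothesis F_lambda : lambda_submanifold A F lambda.
Variables (P : pred 'I_m) (r : R).
Hypothesis r_gt0 : 0 < r.
Hypothesis r_root : r ^+ 2 + lambda * r = n%:R - #|[pred i | ~~ P i]|%:R.
Hypothesis F_cylinder : forall x, partial_sqnorm P (F x) <= r ^+ 2.

Let u x := partial_sqnorm P (F x).
Let N x := partial_sqnorm predT (F x).
Let O := [set x | u x < r ^+ 2].

Lemma partial_sqnorm_continuous (Q : pred 'I_m) :
  continuous (fun x => partial_sqnorm Q (F x)).
Proof.
move=> x; have [cF _] := F_proper.
have ci i : {for x, continuous (fun x => F x 0 i)}.
  apply: (@continuous_comp _ _ _ F (fun X : 'rV[R]_m => X 0 i)).
    exact: cF.
  exact: coord_continuous.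
by apply: continuous_at_sum => i _; apply: continuous_atM; exact: ci.
Qed.

Lemma open_inside : open O.
Proof.
rewrite openE => x Ox.
exact: (cvgr_lt _ (@partial_sqnorm_continuous P x) _ Ox).
Qed.

(** In a chart around a point outside [O], r^2 - u is a nonnegative supersolution that vanishes at
    that point, hence near it. *)
Lemma closed_inside : closed O.
Proof.
rewrite -(setCK O); apply: open_closedC; rewrite openE => x /negP.
rewrite -leNgt => ux.
have {}ux : u x = r ^+ 2 by apply/eqP; rewrite eq_le ux F_cylinder.
have [c Ac cx] := A_cover x.
have cy : chart_codom c (Defs.coord c x) by exists x.
have ncodom : \forall y \near Defs.coord c x, chart_codom c y.
  by apply: open_nbhs_nbhs; split=> //; exact: codom_open.
have super : \forall y \near Defs.coord c x, supersolution_at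
    (fun z => r ^+ 2 - partial_sqnorm P (F (param c z)))
    (fun z => coframe ('J (F \o param c) z)) (drift (F \o param c)) y.
  apply: filterS ncodom => y ydom.
  apply: (supersolution_partial_sqnorm lambda_ge0 F_immersion F_lambda Ac ydom
    (ltW r_gt0) r_root).
  exact: F_cylinder.
have w0 : r ^+ 2 - partial_sqnorm P (F (param c (Defs.coord c x))) = 0.
  by rewrite coordK //; move: ux; rewrite /u => ->; rewrite subrr.
have := near_coord cx (strong_minimum_principle super w0).
apply: filterS => x' [cx' /eqP]; rewrite coordK// subr_eq0 => /eqP E.
by rewrite /O /setC/= /u -E ltxx.
Qed.

Lemma compact_inside_ball (t : R) : compact (O `&` [set x | N x <= t]).
Proof.
rewrite setIC; apply: compact_closedI; last exact: closed_inside.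
have -> : [set x | N x <= t] = F @^-1` [set X | sqdist X 0 <= t].
  have E x : N x = sqdist (F x) 0.
    by rewrite sqdistE; apply: eq_bigr => i _; rewrite mxE subr0.
  by apply/seteqP; split=> x /=; rewrite E.
by have [_] := F_proper; apply; exact: compact_sqdist_le.
Qed.

(** [O] is open, so the maximum is local and L (u - eps N) <= 0 there; the lower bound for u and the
    upper bound for N, both halved, give the inequality. *)
Lemma local_max_estimate (eps : R) x : O x -> 0 <= eps ->
  (forall x', O x' -> u x' - eps * N x' <= u x - eps * N x) ->
  (r - Num.sqrt (u x)) * (r + Num.sqrt (u x) + lambda) <=
  eps * (n%:R + lambda * Num.sqrt (N x) - Num.sqrt (N x) ^+ 2).
Proof.
move=> Ox eps0 xmax; set s := Num.sqrt (u x); set S := Num.sqrt (N x).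
have [c Ac cx] := A_cover x.
have cy : chart_codom c (Defs.coord c x) by exists x.
have est := gen_at_partial_sqnorm lambda_ge0 F_immersion F_lambda Ac.
have [a ga /andP[+ _]] := est P _ cy.
have [b gb /andP[_]] := est predT _ cy.
rewrite /= coordK// -r_root -/(u x) -/(N x) -/s -/S => leb lea.
have lmin : \forall y \near Defs.coord c x,
   -1 * (partial_sqnorm P \o (F \o param c)) (Defs.coord c x) +
     eps * (partial_sqnorm predT \o (F \o param c)) (Defs.coord c x) <=
   -1 * (partial_sqnorm P \o (F \o param c)) y +
     eps * (partial_sqnorm predT \o (F \o param c)) y.
  have nO : \forall x' \near x, O x'.
    by apply: open_nbhs_nbhs; split=> //; exact: open_inside.
  apply: filterS (near_param cx nO) => y /xmax.
  by rewrite /= coordK// -/(u x) -/(N x) /u /N; lra.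
have := gen_at_min lmin (gen_atD (gen_atZ (-1) ga) (gen_atZ eps gb)).
have -> : (r - s) * (r + s + lambda) =
    r ^+ 2 + lambda * r - lambda * s - s ^+ 2 by ring.
have := ler_wpM2l eps0 leb; lra.
Qed.

(* The maximum is attained because F is proper and u is bounded. *)
Lemma attained_max (eps : R) : 0 < eps -> O !=set0 -> exists2 x, O x &
  forall x', O x' -> u x' - eps * N x' <= u x - eps * N x.
Proof.
move=> eps0 [x0 Ox0].
(* Where N > tau, the bound u <= r^2 already puts u - eps N below its value at [x0]. *)
pose tau := N x0 + r ^+ 2 / eps.
have K0 : O `&` [set x | N x <= tau] !=set0.
  by exists x0; split=> //=; rewrite lerDl divr_ge0// ?sqr_ge0// ltW.
have cPhi : continuous (fun x => u x - eps * N x).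
  move=> x; apply: continuous_atB; first exact: partial_sqnorm_continuous.
  apply: continuous_atM; first exact: cst_continuous.
  exact: partial_sqnorm_continuous.
have [x /[!inE] -[Ox _] xmax] := compact_EVT_max K0 (@compact_inside_ball tau)
  (continuous_subspaceT cPhi).
exists x => // x' Ox'; have [Nx'|Nx'] := leP (N x') tau.
  by apply: xmax; rewrite inE; split.
have m0 : u x0 - eps * N x0 <= u x - eps * N x.
  apply: xmax; rewrite inE; split=> //=.
  by rewrite lerDl divr_ge0// ?sqr_ge0// ltW.
apply: le_trans m0.
have := F_cylinder x'; rewrite -/(u x') => ux'.
have u0 : 0 <= u x0 by exact: partial_sqnorm_ge0.
have : eps * tau < eps * N x' by rewrite ltr_pM2l.
rewrite /tau mulrDr mulrCA mulfV ?gt_eqF// mulr1.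
rewrite -/(u x0) -/(N x0); lra.
Qed.

Lemma inside_empty : ~ (O !=set0).
Proof.
move=> O0.
(* If |X| = S > R0, then S >= 1 and S^2 >= R0 S >= n + lambda S, so the right side of
   [local_max_estimate] is at most 0 while its left side is positive. *)
pose R0 : R := n%:R + lambda + 1; have R0_ge1 : 1 <= R0.
  by rewrite lerDr addr_ge0.
have [mu mu0 muK] : exists2 mu, 0 < mu &
    forall x, (O `&` [set x | N x <= R0 ^+ 2]) x -> mu <= r ^+ 2 - u x.
  apply: (@compact_pos_lbound _ _ _ (fun x => r ^+ 2 - u x)
      (@compact_inside_ball _)).
    move=> x _; have cu : {for x, continuous u}.
      exact: partial_sqnorm_continuous.
    by have := continuous_atB (@cst_continuous _ _ (r ^+ 2) x) cu.
  by move=> x [Ox _]; rewrite subr_gt0.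
have b0 : 0 <= n%:R + lambda * R0.
  by rewrite addr_ge0// mulr_ge0// (le_trans ler01).
(* If |X| <= R0, the left side of [local_max_estimate] is at least r^2 - |u|^2 >= mu, and this eps
   keeps the right side below mu. *)
pose eps := mu / (n%:R + lambda * R0 + 1).
have eps0 : 0 < eps by rewrite divr_gt0// ltr_pwDr.
have epsE : eps * (n%:R + lambda * R0) < mu.
  by rewrite /eps mulrAC ltr_pdivrMr ?ltr_pwDr// ltr_pM2l// ltrDl.
have [x Ox xmax] := attained_max eps0 O0.
have := local_max_estimate Ox (ltW eps0) xmax.
have u2 : Num.sqrt (u x) ^+ 2 = u x by rewrite sqr_sqrtr ?partial_sqnorm_ge0.
have N2 : Num.sqrt (N x) ^+ 2 = N x by rewrite sqr_sqrtr ?partial_sqnorm_ge0.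
have := sqrtr_ge0 (u x); have := sqrtr_ge0 (N x).
move: (Num.sqrt (u x)) (Num.sqrt (N x)) u2 N2 => s S u2 N2 S0 s0.
have s_r : s < r.
  by rewrite -(ltr_pXn2r (n := 2)) ?nnegrE ?(ltW r_gt0)// u2.
have lamS : 0 <= lambda * S by rewrite mulr_ge0.
have [SR|SR] := leP S R0.
  have mu_s : mu <= r ^+ 2 - s ^+ 2.
    rewrite u2; apply: muK; split=> //=.
    by rewrite -N2 ler_pXn2r ?nnegrE ?(le_trans ler01 R0_ge1).
  have : eps * (n%:R + lambda * S - S ^+ 2) <= eps * (n%:R + lambda * R0).
    rewrite ler_pM2l//; have := ler_wpM2l lambda_ge0 SR; have := sqr_ge0 S; lra.
  have : 0 <= (r - s) * lambda by rewrite mulr_ge0// subr_ge0 ltW.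
  have -> : (r - s) * (r + s + lambda) =
      (r - s) * lambda + (r ^+ 2 - s ^+ 2) by ring.
  lra.
have S1 : 1 <= S by rewrite (le_trans R0_ge1)// ltW.
have neg : n%:R + lambda * S - S ^+ 2 <= 0.
  have : R0 * S <= S ^+ 2 by rewrite expr2 ler_pM2r ?ltW// (lt_le_trans ltr01).
  have : n%:R <= n%:R * S :> R by rewrite ler_peMr.
  rewrite /R0 !mulrDl; lra.
have : 0 < (r - s) * (r + s + lambda).
  by rewrite mulr_gt0 ?subr_gt0// ltr_wpDr// ltr_wpDr.
have : eps * (n%:R + lambda * S - S ^+ 2) <= 0.
  by rewrite pmulr_rle0.
lra.
Qed.

Lemma cylinder_rigidity x : partial_sqnorm P (F x) = r ^+ 2.
Proof.
apply/eqP; rewrite eq_le F_cylinder leNgt/=; apply/negP => ux.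
by apply: inside_empty; exists x.
Qed.

End cylinder.

Theorem theorem12 (R : realType) (n p : nat) (n_ge1 : (1 <= n)%N)
    (p_ge1 : (1 <= p)%N) (lambda : R) (lambda_ge0 : 0 <= lambda)
    (M : topologicalType) (A : set (chart R n M)) (F : M -> 'rV[R]_(n + p))
    (M_manifold : smooth_manifold A)
    (F_immersion : smooth_immersion A F)
    (F_proper : proper_map F)
    (F_complete : complete_submanifold A F)
    (F_lambda : lambda_submanifold A F lambda)
    (k : nat) (k_ge : (p <= k)%N) (k_le : (k <= n + p - 2)%N)
    (q : nat) (q_def : q = (n + p - k - 1)%N)
    (e : (n + p = k.+1 + q)%N)
    (r : R)
    (r_def : r = (- lambda
                  + Num.sqrt (lambda ^+ 2 + 4 * (n%:R - q%:R))) / 2) :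
  range F `<=` split_coords e @^-1` (eclosed_ball r `*` [set: 'rV[R]_q]) ->
  range F `<=` split_coords e @^-1` (esphere r `*` [set: 'rV[R]_q]).
Proof.
move=> F_ball.
(* From k >= p it follows that q <= n - 1; this is what makes r strictly positive. *)
have nq : (1 : R) <= n%:R - q%:R.
  have : (q + 1)%N%:R <= n%:R :> R by rewrite ler_nat; lia.
  by rewrite natrD; lra.
have [r_gt0 r_root] : 0 < r /\ r ^+ 2 + lambda * r = n%:R - q%:R.
  have D0 : 0 <= lambda ^+ 2 + 4 * (n%:R - q%:R).
    by have := sqr_ge0 lambda; lra.
  have := sqr_sqrtr D0; have := sqrtr_ge0 (lambda ^+ 2 + 4 * (n%:R - q%:R)).
  rewrite r_def; move: (Num.sqrt _) => t t0 t2; split; last by lra.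
  have : lambda < t by rewrite -(ltr_pXn2r (n := 2)) ?nnegrE// t2; lra.
  lra.
have [_ _ A_cover _] := M_manifold.
pose P := [pred i : 'I_(n + p) | (i < k.+1)%N].
have normE x :
    enorm (split_coords e (F x)).1 = Num.sqrt (partial_sqnorm P (F x)).
  by rewrite /enorm edot_split_coords.
have F_cylinder x : partial_sqnorm P (F x) <= r ^+ 2.
  have [/= + _] : (eclosed_ball r `*` [set: 'rV[R]_q]) (split_coords e (F x)).
    by apply: F_ball; exists x.
  rewrite /eclosed_ball /= normE => le_r.
  rewrite -[leLHS]sqr_sqrtr ?partial_sqnorm_ge0//.
  by rewrite ler_pXn2r ?nnegrE ?sqrtr_ge0// ltW.
have root : r ^+ 2 + lambda * r = n%:R - #|[pred i | ~~ P i]|%:R.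
  by rewrite r_root (card_split_coords e).
move=> _ [x _ <-]; split=> //=; rewrite /esphere/= normE.
rewrite (cylinder_rigidity lambda_ge0 A_cover F_immersion F_proper F_lambda
  r_gt0 root F_cylinder).
by rewrite sqrtr_sqr ger0_norm// ltW.
Qed.
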